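(* Every compact Hausdorff space arises as the boundary of a coarse proximity space; that is, for every compact Hausdorff space $Z$ there is a coarse proximity space $(Y,\mathcal{B},{\bf b})$ whose boundary $\mathcal{U}Y$ is homeomorphic to $Z$.
   Context: Coarse proximity spaces. A bornology $\mathcal{B}$ on a set $X$ is a family of subsets containing all singletons and closed under subsets and finite unions; its members are called bounded, other subsets unbounded. A coarse proximity on $(X,\mathcal{B})$ is a relation ${\bf b}$ on the power set of $X$ such that for all $A,B,C\subseteq X$: (1) $A{\bf b}B\Rightarrow B{\bf b}A$; (2) $A{\bf b}B\Rightarrow A,B\notin\mathcal{B}$; (3) $A\cap B\notin\mathcal{B}\Rightarrow A{\bf b}B$; (4) $(A\cup B){\bf b}C\iff A{\bf b}C$ or $B{\bf b}C$; (5) $A\bar{\bf b}B\Rightarrow\exists E\subseteq X$ with $A\bar{\bf b}E$ and $(X\setminus E)\bar{\bf b}B$ (a bar denotes negation). Then $(X,\mathcal{B},{\bf b})$ is a coarse proximity space. Proximities and clusters. A proximity on a set $X$ is a relation $\delta$ on the power set with: (1) $A\delta B\Rightarrow B\delta A$; (2) $A\delta B\Rightarrow A,B\ne\emptyset$; (3) $A\cap B\neq\emptyset\Rightarrow A\delta B$; (4) $A\delta(B\cup C)\iff A\delta B$ or $A\delta C$; (5) $A\bar\delta B\Rightarrow\exists E\subseteq X$ with $A\bar\delta E$ and $(X\setminus E)\bar\delta B$. It is separated if $\{x\}\delta\{y\}\iff x=y$. It induces the topology in which $A$ is closed iff ($A\delta\{x\}\Rightarrow x\in A$). A cluster in $(X,\delta)$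 is a collection $\sigma$ of subsets of $X$ such that: $A,B\in\sigma\Rightarrow A\delta B$; if $A\delta B$ for all $B\in\sigma$ then $A\in\sigma$; if $A\cup B\in\sigma$ then $A\in\sigma$ or $B\in\sigma$. For $\delta$ separated, the Smirnov compactification $\mathfrak{X}$ is the set of all clusters with the proximity $\mathcal{A}\delta^*\mathcal{C}$ iff $A\delta C$ for all $A,C\subseteq X$ such that $A\in\sigma$ for all $\sigma\in\mathcal{A}$ and $C\in\sigma$ for all $\sigma\in\mathcal{C}$; it is compact Hausdorff. Boundary. For a coarse proximity space $(X,\mathcal{B},{\bf b})$, the discrete extension is the separated proximity $A\delta_{dis}B\iff A\cap B\ne\emptyset$ or $A{\bf b}B$. The boundary $\mathcal{U}X$ is the set of clusters in $(X,\delta_{dis})$ containing no bounded set, with the subspace proximity and topology inherited from the Smirnov compactification $\mathfrak{X}$ of $(X,\delta_{dis})$. *)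

(* Defs.v *)
From HB Require Import structures.
From mathcomp Require Import all_boot all_order all_algebra.
From mathcomp Require Import all_classical.
From mathcomp Require Import topology.

Set Implicit Arguments.
Unset Strict Implicit.
Unset Printing Implicit Defensive.

Local Open Scope classical_set_scope.

(* [bounded0] is closure under the empty union; it follows from the other
   axioms as soon as [X] is inhabited, and only matters for empty [X]. *)
Record bornology (X : Type) := Bornology {
  bounded :> set X -> Prop;
  bounded0 : bounded set0;
  bounded1 : forall x : X, bounded [set x];
  bounded_sub : forall A C : set X, A `<=` C -> bounded C -> bounded A;
  boundedU : forall A C : set X, bounded A -> bounded C -> bounded (A `|` C)
}.

Record coarse_proximity (X : Type) (B : bornology X) := CoarseProximity {
  coarse_near :> set X -> set X -> Prop;
  coarse_sym : forall A C : set X, coarse_near A C -> coarse_near C A;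
  coarse_unbounded : forall A C : set X,
    coarse_near A C -> ~ B A /\ ~ B C;
  coarse_setI : forall A C : set X, ~ B (A `&` C) -> coarse_near A C;
  coarse_setU : forall A C D : set X,
    coarse_near (A `|` C) D <-> coarse_near A D \/ coarse_near C D;
  coarse_strong : forall A C : set X, ~ coarse_near A C ->
    exists E : set X, ~ coarse_near A E /\ ~ coarse_near (~` E) C
}.

Record proximity (X : Type) := Proximity {
  near_to :> set X -> set X -> Prop;
  prox_sym : forall A C : set X, near_to A C -> near_to C A;
  prox_nonempty : forall A C : set X, near_to A C -> A !=set0 /\ C !=set0;
  prox_setI : forall A C : set X, A `&` C !=set0 -> near_to A C;
  prox_setU : forall A C D : set X,
    near_to A (C `|` D) <-> near_to A C \/ near_to A D;
  prox_strong : forall A C : set X, ~ near_to A C ->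
    exists E : set X, ~ near_to A E /\ ~ near_to (~` E) C
}.

Definition separated_proximity (X : Type) (d : proximity X) : Prop :=
  forall x y : X, d [set x] [set y] <-> x = y.

Section ProximityTheory.
Variables (X : Type) (d : proximity X).

Lemma prox_setUl (A C D : set X) : d (A `|` C) D <-> d A D \/ d C D.
Proof.
split=> [/prox_sym/prox_setU[]/prox_sym h|[]/prox_sym h].
- by left.
- by right.
- by apply/prox_sym/prox_setU; left.
- by apply/prox_sym/prox_setU; right.
Qed.

Lemma prox_subr (A C D : set X) : C `<=` D -> d A C -> d A D.
Proof. by move=> /setUidPr <- h; apply/prox_setU; left. Qed.

Lemma prox_subl (A C D : set X) : A `<=` C -> d A D -> d C D.
Proof. by move=> sAC /prox_sym/(prox_subr sAC)/prox_sym. Qed.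

End ProximityTheory.

(* [prox_space d] is a copy of the carrier of [d], equipped with the topology
   induced by [d]. *)
Definition prox_space (X : Type) (d : proximity X) : Type := X.

Definition prox_closed (X : Type) (d : proximity X) (A : set X) : Prop :=
  forall x : X, d A [set x] -> A x.

Section ProximityTopology.
Variables (X : Type) (d : proximity X).

HB.instance Definition _ := gen_eqMixin (prox_space d).
HB.instance Definition _ := gen_choiceMixin (prox_space d).

Definition prox_open : set_system (prox_space d) :=
  [set U | prox_closed d (~` U)].

Lemma prox_openT : prox_open setT.
Proof. by move=> x; rewrite setCT => /prox_nonempty[[? []]]. Qed.

Lemma prox_openI : setI_closed prox_open.
Proof.
move=> U V oU oV x; rewrite setCI => /prox_setUl[/oU|/oV] h; [left|right];
  exact: h.
Qed.

Lemma prox_open_bigcup (I : Type) (f : I -> set (prox_space d)) :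
  (forall i, prox_open (f i)) -> prox_open (\bigcup_i f i).
Proof.
move=> of_ x h [i _ fix_]; apply: (of_ i x) fix_; apply: prox_subl h.
by move=> y nfy fiy; apply: nfy; exists i.
Qed.

HB.instance Definition _ := isOpenTopological.Build (prox_space d)
  prox_openT prox_openI prox_open_bigcup.

Lemma closed_prox_closed (A : set (prox_space d)) :
  closed A <-> prox_closed d A.
Proof.
rewrite -openC; split=> [|cA].
  by move=> oA; have : prox_open (~` A) by []; rewrite /prox_open /= setCK.
by have : prox_open (~` A) by rewrite /prox_open /= setCK.
Qed.

End ProximityTopology.

Record cluster (X : Type) (d : proximity X) := Cluster {
  cluster_mem :> set X -> Prop;
  cluster_near : forall A C : set X,
    cluster_mem A -> cluster_mem C -> d A C;
  cluster_max : forall A : set X,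
    (forall C : set X, cluster_mem C -> d A C) -> cluster_mem A;
  cluster_setU : forall A C : set X,
    cluster_mem (A `|` C) -> cluster_mem A \/ cluster_mem C
}.

Section Smirnov.
Variables (X : Type) (d : proximity X).
Implicit Types (s : cluster d) (S T R : set (cluster d)) (A C E : set X).

Definition absorbs A S : Prop := forall s, S s -> s A.

Definition smirnov_near S T : Prop :=
  forall A C, absorbs A S -> absorbs C T -> d A C.

Lemma cluster_notin s A : ~ s A -> s (~` A).
Proof.
move=> nsA; have : s (A `|` ~` A).
  rewrite setUv; apply: cluster_max => C sC.
  have [_ [x Cx]] := prox_nonempty (cluster_near sC sC).
  by apply: prox_setI; exists x.
by case/cluster_setU.
Qed.

Lemma smirnov_nearN S T : ~ smirnov_near S T ->
  exists A C, [/\ absorbs A S, absorbs C T & ~ d A C].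
Proof.
move=> nST; apply: contrapT => h; apply: nST => A C aA aC.
by apply: contrapT => nd; apply: h; exists A, C.
Qed.

Lemma smirnov_sym S T : smirnov_near S T -> smirnov_near T S.
Proof. by move=> h A C aA aC; apply/prox_sym/h. Qed.

Lemma smirnov_nonempty S T : smirnov_near S T -> S !=set0 /\ T !=set0.
Proof.
have key (S' T' : set (cluster d)) : smirnov_near S' T' -> S' !=set0.
  move=> h; apply: contrapT => /set0P/negP/negPn/eqP S0.
  have aT : absorbs setT T'.
    move=> s _; apply: cluster_max => C sC.
    have [_ [x Cx]] := prox_nonempty (cluster_near sC sC).
    by apply: prox_setI; exists x.
  have a0 : absorbs set0 S' by move=> s; rewrite S0.
  by have [[x []]] := prox_nonempty (h _ _ a0 aT).
by move=> h; split; [exact: key h|exact: key (smirnov_sym h)].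
Qed.

Lemma smirnov_setI S T : S `&` T !=set0 -> smirnov_near S T.
Proof.
by move=> [s [Ss Ts]] A C aA aC; apply: cluster_near (aA s Ss) (aC s Ts).
Qed.

Lemma smirnov_setU S T R :
  smirnov_near S (T `|` R) <-> smirnov_near S T \/ smirnov_near S R.
Proof.
split; last first.
  by case=> h A C aA aC; apply: h => // s hs; apply: aC; [left|right].
move=> h; apply: contrapT => /not_orP[/smirnov_nearN[A1 [C1 [aA1 aC1 n1]]]
  /smirnov_nearN[A2 [C2 [aA2 aC2 n2]]]].
have [E1 [nE1 nE1']] := prox_strong (fun h1 => n1 (prox_sym h1)).
have [E2 [nE2 nE2']] := prox_strong (fun h2 => n2 (prox_sym h2)).
have aE : absorbs (E1 `&` E2) S.
  move=> s Ss; rewrite -[_ `&` _]setCK setCI.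
  apply: cluster_notin => /cluster_setU[] sE.
  - exact: nE1' (cluster_near sE (aA1 s Ss)).
  - exact: nE2' (cluster_near sE (aA2 s Ss)).
have aC : absorbs (C1 `|` C2) (T `|` R).
  move=> s [Ts|Rs]; apply: cluster_max => D sD; apply/prox_setUl.
  - by left; exact: cluster_near (aC1 s Ts) sD.
  - by right; exact: cluster_near (aC2 s Rs) sD.
have /prox_setU[] := h _ _ aE aC => /prox_sym hE.
- by apply: nE1; apply: prox_subr hE; exact: subIsetl.
- by apply: nE2; apply: prox_subr hE; exact: subIsetr.
Qed.

Lemma smirnov_strong S T : ~ smirnov_near S T ->
  exists R, ~ smirnov_near S R /\ ~ smirnov_near (~` R) T.
Proof.
move=> /smirnov_nearN[A [C [aA aC nAC]]].
have [E [nAE nEC]] := prox_strong nAC.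
exists [set s | s E]; split=> h.
- by apply/nAE/h.
- by apply/nEC/h => // s; exact: cluster_notin.
Qed.

Definition smirnov_prox : proximity (cluster d) :=
  Proximity smirnov_sym smirnov_nonempty smirnov_setI smirnov_setU
    smirnov_strong.

End Smirnov.

Notation smirnov d := (prox_space (smirnov_prox d)).

Section DiscreteExtension.
Variables (X : Type) (B : bornology X) (b : coarse_proximity B).
Implicit Types A C D E : set X.

Definition discrete_near A C : Prop := A `&` C !=set0 \/ b A C.

Lemma discrete_sym A C : discrete_near A C -> discrete_near C A.
Proof. by case=> [h|/coarse_sym]; [left; rewrite setIC|right]. Qed.

Lemma discrete_nonempty A C : discrete_near A C -> A !=set0 /\ C !=set0.
Proof.
have unbounded_nonempty D : ~ B D -> D !=set0.
  move=> nBD; apply: contrapT => /set0P/negP/negPn/eqP D0.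
  by apply: nBD; rewrite D0; exact: bounded0.
case=> [[x [Ax Cx]]|/coarse_unbounded[nA nC]]; first by split; exists x.
by split; exact: unbounded_nonempty.
Qed.

Lemma discrete_setI A C : A `&` C !=set0 -> discrete_near A C.
Proof. by left. Qed.

Lemma discrete_setU A C D :
  discrete_near A (C `|` D) <-> discrete_near A C \/ discrete_near A D.
Proof.
split.
- case=> [[x [Ax [Cx|Dx]]]|/coarse_sym/coarse_setU[]/coarse_sym h].
  + by left; left; exists x.
  + by right; left; exists x.
  + by left; right.
  + by right; right.
- case=> -[[x [Ax Cx]]|/coarse_sym h].
  + by left; exists x; split=> //; left.
  + by right; apply/coarse_sym/coarse_setU; left.
  + by left; exists x; split=> //; right.
  + by right; apply/coarse_sym/coarse_setU; right.
Qed.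

Lemma coarse_subl A C D : A `<=` C -> b A D -> b C D.
Proof. by move=> /setUidPr <- h; apply/coarse_setU; left. Qed.

Lemma discrete_strong A C : ~ discrete_near A C ->
  exists E, ~ discrete_near A E /\ ~ discrete_near (~` E) C.
Proof.
move=> /not_orP[AC0 nAC]; have [E [nAE nEC]] := coarse_strong nAC.
exists ((E `\` A) `|` C); split.
- case=> [[x [Ax [[]//|Cx]]]|]; first by apply: AC0; exists x.
  move=> /coarse_sym/coarse_setU[]/coarse_sym// /coarse_sym h.
  by apply/nAE/coarse_sym/(coarse_subl _ h) => x [].
- case=> [[x [nx Cx]]|h]; first by apply: nx; right.
  have /coarse_setU[] // : b (~` E `|` A) C.
  apply: coarse_subl h => x nx; have [Ax|nAx] := pselect (A x); first by right.
  by left=> Ex; apply: nx; left.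
Qed.

Definition discrete_extension : proximity X :=
  Proximity discrete_sym discrete_nonempty discrete_setI discrete_setU
    discrete_strong.

Lemma discrete_extension_separated : separated_proximity discrete_extension.
Proof.
move=> x y; split=> [[[z [-> ->]]//|/coarse_unbounded[]]|->].
- by move=> /(_ (bounded1 B x)).
- by left; exists y.
Qed.

(* Coerced to a type, this set carries the subspace topology of [smirnov]. *)
Definition boundary : set (smirnov discrete_extension) :=
  [set s | forall A, s A -> ~ B A].

End DiscreteExtension.

Arguments boundary {X B} b.

Definition homeomorphic (S T : topologicalType) : Prop :=
  exists (f : S -> T) (g : T -> S),
    [/\ cancel f g, cancel g f, continuous f & continuous g].

(* Main.v *)
Require Import Defs.
From HB Require Import structures.
From mathcomp Require Import all_boot all_order all_algebra.
From mathcomp Require Import all_classical.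
From mathcomp Require Import topology.

Set Implicit Arguments.
Unset Strict Implicit.
Unset Printing Implicit Defensive.

Local Open Scope classical_set_scope.

(** Spread [Z] out to infinity: let [Y] be a set with a bornology and a map
    [p] to [Z] all of whose fibers are unbounded (below, [Z * nat] with finite
    sets as bounded sets).  A subset of [Y] then leaves a trace at infinity in
    [Z], its limit set: the points all of whose neighborhoods have an unbounded
    part of the subset above them.  Limit sets are closed, turn unions into
    unions, and, as [Z] is compact, are empty exactly for bounded sets.
    Declaring two subsets coarsely near when their limit sets meet gives a
    coarse proximity; its strong axiom is the normality of [Z].

    The points of the boundary are the clusters [sigma_z] of the subsets whose
    limit set contains [z].  Indeed, if a cluster has no bounded member, then by
    compactness there is a [z] such that [p @^-1` U] belongs to it for every
    neighborhood [U] of [z] ([compact_grill]); since members of a cluster are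
    near each other, regularity of [Z] puts [z] in the limit set of every
    member, and two clusters, one of which contains the other, are equal
    ([boundary_pointP]).  Different points give different clusters because the
    limit set of a fiber is a single point.

    Finally [z |-> sigma_z] is a homeomorphism.  It is continuous because limit
    sets are closed: a set absorbing [sigma_w] for all [w] in some [S] absorbs
    [sigma_z] for all [z] in the closure of [S].  It sends closed sets [K] to
    closed sets because [p @^-1` K] absorbs the image of [K], while the limit
    set of this preimage does not exceed [K]. *)

(** * Grills and clusters *)

(** A grill is what a union of ultrafilters looks like; the point found here is
    a cluster point of the filter of the sets whose complement is outside the
    grill. *)
Lemma compact_grill (Z : topologicalType) (G : set (set Z)) :
  compact [set: Z] -> G setT -> ~ G set0 ->
  (forall U V, U `<=` V -> G U -> G V) ->
  (forall U V, G (U `|` V) -> G U \/ G V) ->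
  exists z : Z, forall U, nbhs z U -> G U.
Proof.
move=> cZ GT G0 GS GU; pose F : set_system Z := [set V | ~ G (~` V)].
have FF : Filter F.
  split; rewrite /F /=; first by rewrite setCT.
  - by move=> P Q nP nQ; rewrite /F /= setCI => /GU[].
  - by move=> P Q PQ nP GQ; apply/nP/(GS _ _ (subsetC PQ)).
have PF : ProperFilter F by split=> //; rewrite /F /= setC0; apply.
have [z [_ Fz]] := cZ F PF filterT; exists z => U Uz.
apply: contrapT => nU; have FU : F (~` U) by rewrite /F /= setCK.
by have [x []] := Fz _ _ FU Uz.
Qed.

Section Clusters.
Context {X : Type} {d : proximity X}.
Implicit Types s t : Defs.cluster d.

Lemma cluster_sub s (A C : set X) : A `<=` C -> s A -> s C.
Proof.
move=> AC sA; apply: cluster_max => D sD.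
exact: prox_subl AC (cluster_near sA sD).
Qed.

Lemma cluster0 s : ~ s set0.
Proof. by move=> s0; have [[x []]] := prox_nonempty (cluster_near s0 s0). Qed.

Lemma clusterT s : s setT.
Proof. by rewrite -setC0; apply/cluster_notin/cluster0. Qed.

Lemma cluster_eq s t : (forall A, s A <-> t A) -> s = t.
Proof.
move=> st; have {st} : cluster_mem s = cluster_mem t.
  by apply/funext => A; apply/propext.
case: s t => [s s1 s2 s3] [t t1 t2 t3] /= st.
by subst t; congr Cluster; exact: Prop_irrelevance.
Qed.

(** A member of [t] is near everything in [t], hence near everything in [s],
    and so belongs to [s]. *)
Lemma cluster_sub_eq s t : (forall A, s A -> t A) -> s = t.
Proof.
move=> st; apply: cluster_eq => A; split; first exact: st.
by move=> tA; apply: cluster_max => C /st; exact: cluster_near.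
Qed.

End Clusters.

(** * Limit sets *)

Section LimitSets.
Context {Y : Type} {Z : topologicalType}.
Variables (B : bornology Y) (p : Y -> Z).
Implicit Types (A C : set Y) (U K : set Z) (z : Z).

Definition limit_set A : set Z :=
  [set z | forall U, nbhs z U -> ~ B (A `&` p @^-1` U)].

Lemma limit_setN A z :
  ~ limit_set A z -> exists2 U, nbhs z U & B (A `&` p @^-1` U).
Proof.
move=> nA; apply: contrapT => h; apply: nA => U Uz BU.
by apply: h; exists U.
Qed.

Lemma limit_setS A C : A `<=` C -> limit_set A `<=` limit_set C.
Proof.
move=> AC z Az U Uz BC; apply: (Az U Uz).
by apply: bounded_sub BC; exact: setSI.
Qed.

Lemma limit_setU A C z :
  limit_set (A `|` C) z <-> limit_set A z \/ limit_set C z.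
Proof.
split; last by case; apply: limit_setS; [left|right].
move=> ACz; apply: contrapT => /not_orP[/limit_setN[U Uz BU]].
move=> /limit_setN[V Vz BV]; apply: (ACz _ (filterI Uz Vz)).
apply: bounded_sub (boundedU BU BV).
by move=> y [[Ay|Cy] [Uy Vy]]; [left|right].
Qed.

Lemma limit_set_bounded A z : limit_set A z -> ~ B A.
Proof.
move=> Az BA; apply: (Az _ filterT).
by apply: bounded_sub BA; exact: subIsetl.
Qed.

Lemma limit_set_closed A : closed (limit_set A).
Proof.
move=> z clz U; rewrite nbhsE => -[V [oV Vz] VU] BU.
have [w [Aw Vw]] := clz V (open_nbhs_nbhs (conj oV Vz)).
apply: (Aw V (open_nbhs_nbhs (conj oV Vw))).
by apply: bounded_sub BU; apply: setIS => y; exact: VU.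
Qed.

Lemma limit_set_closure A U : A `<=` p @^-1` U -> limit_set A `<=` closure U.
Proof.
move=> AU z Az V Vz; apply: contrapT => UV0; apply: (Az V Vz).
apply: bounded_sub (bounded0 B) => y [/AU Uy Vy].
by apply: UV0; exists (p y).
Qed.

Lemma limit_set_sub_closed A K :
  closed K -> A `<=` p @^-1` K -> limit_set A `<=` K.
Proof. by move=> cK /limit_set_closure; rewrite -(closure_id _).1. Qed.

Lemma limit_set_preimage U z : nbhs z U -> ~ limit_set (~` (p @^-1` U)) z.
Proof.
move=> Uz /(_ U Uz); apply.
by rewrite setICl; exact: bounded0.
Qed.

(** The sets [U] of [Z] above which [A] is unbounded form a grill. *)
Lemma limit_set_nonempty A :
  compact [set: Z] -> ~ B A -> limit_set A !=set0.
Proof.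
move=> cZ nBA.
apply: (@compact_grill Z [set U | ~ B (A `&` p @^-1` U)] cZ) => /=.
- by rewrite preimage_setT setIT.
- by apply; rewrite preimage_set0 setI0; exact: bounded0.
- move=> U V UV nBU BV; apply/nBU/(bounded_sub _ BV).
  by apply: setIS => y; exact: UV.
- move=> U V; rewrite preimage_setU setIUr => nB.
  by apply/not_andP => -[BU BV]; apply/nB/boundedU.
Qed.

Hypotheses (Zcompact : compact [set: Z]) (Zhausdorff : hausdorff_space Z).

(** * The coarse proximity of meeting limit sets *)

Definition limit_near A C : Prop := limit_set A `&` limit_set C !=set0.

Lemma limit_near_sym A C : limit_near A C -> limit_near C A.
Proof. by rewrite /limit_near setIC. Qed.

Lemma limit_near_unbounded A C : limit_near A C -> ~ B A /\ ~ B C.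
Proof. by move=> [z [Az Cz]]; split; apply: limit_set_bounded; eassumption. Qed.

Lemma limit_near_setI A C : ~ B (A `&` C) -> limit_near A C.
Proof.
move=> /(limit_set_nonempty Zcompact)[z ACz].
by exists z; split; apply: limit_setS ACz.
Qed.

Lemma limit_near_setU A C D :
  limit_near (A `|` C) D <-> limit_near A D \/ limit_near C D.
Proof.
split.
- by move=> [z [/limit_setU[]]]; [left|right]; exists z.
- by move=> [] [z [? Dz]]; exists z; split=> //; apply/limit_setU; [left|right].
Qed.

(** Normality separates the two limit sets by a neighborhood [U] of the second
    one; the preimage of [U] then separates [A] from [C]. *)
Lemma limit_near_strong A C : ~ limit_near A C ->
  exists E, ~ limit_near A E /\ ~ limit_near (~` E) C.
Proof.
move=> nAC; have nC : set_nbhs (limit_set C) (~` limit_set A).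
  apply/set_nbhsP; exists (~` limit_set A); split=> //.
    exact/closed_openC/limit_set_closed.
  by move=> z Cz Az; apply: nAC; exists z.
have [U CU clU] := compact_normal Zhausdorff Zcompact (@limit_set_closed C) nC.
exists (p @^-1` U); split=> -[z [z1 z2]].
- by apply: (clU z) z1; apply: limit_set_closure z2.
- exact: limit_set_preimage (CU z z2) z1.
Qed.

Definition limit_proximity : coarse_proximity B :=
  CoarseProximity limit_near_sym limit_near_unbounded limit_near_setI
    limit_near_setU limit_near_strong.

Let d := discrete_extension limit_proximity.

(** * The points of the boundary *)

Hypothesis fiber_unbounded : forall z, ~ B (p @^-1` [set z]).

Lemma limit_set_fiber z : limit_set (p @^-1` [set z]) z.
Proof.
move=> U /nbhs_singleton Uz; rewrite setIidl; first exact: fiber_unbounded.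
by move=> y /= ->.
Qed.

Lemma limit_set_sub_fiber A z w :
  A `<=` p @^-1` [set z] -> limit_set A w -> w = z.
Proof.
move=> Az; apply: limit_set_sub_closed Az w.
exact: compact_closed Zhausdorff (@compact_set1 _ z).
Qed.

Let limit_at z : set Y -> Prop := [set A | limit_set A z].

Lemma limit_at_near z A C : limit_at z A -> limit_at z C -> d A C.
Proof. by move=> Az Cz; right; exists z. Qed.

Lemma limit_at_max z A : (forall C, limit_at z C -> d A C) -> limit_at z A.
Proof.
move=> Amax; apply: contrapT => nAz.
(* The test set must avoid [A], lest it be near [A] by intersecting it. *)
pose C := p @^-1` [set z] `\` A.
have Cz : limit_set C z.
  have : limit_set (A `|` C) z.
    apply: (limit_setS _ (@limit_set_fiber z)) => y yz.
    by have [Ay|nAy] := pselect (A y); [left|right].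
  by case/limit_setU.
case: (Amax C Cz) => [[y [Ay [_ /(_ Ay)]]] //|[w [Aw Cw]]]; apply: nAz.
by have <- : w = z by apply: limit_set_sub_fiber Cw => y [].
Qed.

Lemma limit_at_setU z A C :
  limit_at z (A `|` C) -> limit_at z A \/ limit_at z C.
Proof. by move/limit_setU. Qed.

Definition limit_cluster z : Defs.cluster d :=
  Cluster (@limit_at_near z) (@limit_at_max z) (@limit_at_setU z).

Lemma limit_cluster_inj : injective limit_cluster.
Proof.
move=> z w zw; have : limit_cluster z (p @^-1` [set z]).
  exact: limit_set_fiber.
by rewrite zw => /(limit_set_sub_fiber (@subset_refl _ _)).
Qed.

Lemma limit_cluster_boundary z : boundary limit_proximity (limit_cluster z).
Proof. by move=> A; exact: limit_set_bounded. Qed.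

(** The difficulty is that members of [s] may be near each other merely because
    they intersect; replacing [p @^-1` U] by its part outside [A] rules this
    out. *)
Lemma boundary_pointP (s : Defs.cluster d) :
  boundary limit_proximity s -> exists z, s = limit_cluster z.
Proof.
move=> sB.
have [z sz] : exists z : Z, forall U, nbhs z U -> s (p @^-1` U).
  apply: (@compact_grill Z [set U | s (p @^-1` U)] Zcompact) => /=.
  - by rewrite preimage_setT; exact: clusterT.
  - by rewrite preimage_set0; exact: cluster0.
  - by move=> U V UV; apply: cluster_sub => y; exact: UV.
  - by move=> U V; rewrite preimage_setU; exact: cluster_setU.
exists z; apply: cluster_sub_eq => A sA; apply: contrapT => nAz.
have [V Vz BV] := limit_setN nAz.
have nA : nbhs z (~` limit_set A).
  by apply: open_nbhs_nbhs; split=> //; exact/closed_openC/limit_set_closed.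
have [W Wz clW] : filter_from (nbhs z) closure (~` limit_set A).
  by apply: (compact_regular Zhausdorff Zcompact (filterT : nbhs z setT)).
pose U := V `&` W.
have : s ((p @^-1` U `&` A) `|` (p @^-1` U `\` A)).
  by rewrite -setIUr setUv setIT; apply/sz/filterI.
case/cluster_setU => [/sB|sU].
  by apply; apply: bounded_sub BV => y [[Vy _] Ay].
case: (cluster_near sU sA) => [[y [[_ nAy] /nAy]] //|[w [Uw Aw]]].
by apply: (clW w) Aw; apply: limit_set_closure Uw => y [[]].
Qed.

(** * Continuity in both directions *)

(** Nearness of sets of clusters is tested on the sets that they absorb, and a
    closed limit set containing all [w] in some set contains [z] in its
    closure. *)
Lemma limit_cluster_continuous : continuous (limit_cluster : Z -> smirnov d).
Proof.
apply/continuous_closedP => T /closed_prox_closed cT z clz.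
apply: cT => A C AT Cz; right; exists z; split; last exact: (Cz (limit_cluster z)).
apply: limit_set_closed; apply: closureS clz => w; exact: (AT (limit_cluster w)).
Qed.

(** The image is closed in the whole compactification: a cluster with a bounded
    member [D] is far from it, since the complement of [D] belongs to every
    [limit_cluster z]. *)
Lemma limit_cluster_closed K :
  closed K -> closed (limit_cluster @` K : set (smirnov d)).
Proof.
move=> cK; apply/closed_prox_closed => s Ks.
have sB : boundary limit_proximity s.
  move=> D sD BD.
  have aD : absorbs (~` D) (limit_cluster @` K).
    move=> _ [z _ <-]; apply: cluster_notin => Dz.
    exact: limit_cluster_boundary Dz BD.
  have aDs : absorbs D [set s] by move=> _ ->.
  by case: (Ks _ _ aD aDs) => [[y []] //|/limit_near_unbounded[_]].
have [z sz] := boundary_pointP sB; exists z; last exact: esym sz.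
apply: contrapT => nKz.
have aK : absorbs (p @^-1` K) (limit_cluster @` K).
  move=> _ [w Kw <-]; apply: (limit_setS _ (@limit_set_fiber w)) => y /= -> //.
have az : absorbs (p @^-1` [set z]) [set s].
  by move=> _ ->; rewrite sz; exact: limit_set_fiber.
case: (Ks _ _ aK az) => [[y [Ky yz]]|[w [Kw zw]]]; apply: nKz.
- by rewrite -yz.
- rewrite -(limit_set_sub_fiber (@subset_refl _ _) zw).
  exact: limit_set_sub_closed Kw.
Qed.

Lemma boundary_homeomorphic :
  homeomorphic (set_type (boundary limit_proximity)) Z.
Proof.
pose g z : set_type (boundary limit_proximity) :=
  SigSub (mem_set (@limit_cluster_boundary z)).
have gE (s : set_type (boundary limit_proximity)) :
    exists z, set_val s = limit_cluster z.
  exact/boundary_pointP/set_valP.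
pose f s := projT1 (cid (gE s)).
have fE s : set_val s = limit_cluster (f s) by exact: (projT2 (cid (gE s))).
exists f, g; split.
- by move=> s; apply: val_inj; rewrite /= -fE.
- by move=> z; apply: limit_cluster_inj; rewrite -fE.
- apply/continuous_closedP => K cK.
  have -> : f @^-1` K = set_val @^-1` (limit_cluster @` K).
    apply/seteqP; split=> s /=; first by move=> Ks; exists (f s).
    by rewrite fE => -[z Kz /limit_cluster_inj <-].
  have /continuous_closedP : continuous
      (set_val : set_type (boundary limit_proximity) -> smirnov d).
    exact: initial_continuous.
  by apply; exact: limit_cluster_closed.
- apply: continuous_comp_initial; exact: limit_cluster_continuous.
Qed.

End LimitSets.

(** * The realizing space *)

Definition finite_bornology (X : Type) : bornology X :=
  Bornology (@finite_set0 X) (@finite_set1 X) (@sub_finite_set X)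
    (fun A C fA fC => eq_ind_r id (conj fA fC) (finite_setU A C)).

Theorem corollary5p3 (Z : topologicalType)
    (Zcompact : compact [set: Z]) (Zhausdorff : hausdorff_space Z) :
  exists (Y : Type) (B : bornology Y) (b : coarse_proximity B),
    homeomorphic (set_type (boundary b)) Z.
Proof.
exists (Z * nat)%type, (finite_bornology (Z * nat)).
exists (limit_proximity (finite_bornology (Z * nat)) fst Zcompact Zhausdorff).
apply: boundary_homeomorphic => z /(finite_image snd) fz; apply: infinite_nat.
by apply: sub_finite_set fz => n _; exists (z, n).
Qed.
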